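(* For every $A\in\mathcal L_\Box$: if $\mathsf{iGLH^\Box}\nvdash A$, then there is a substitution $\beta$ such that $\mathsf{iGLC_aH_\sigma}\nvdash\beta(A)$.
   Context: Formulas. The modal language $\mathcal L_\Box$ is built from countably many propositional variables $x_1,x_2,\dots$, countably many propositional parameters $p_1,p_2,\dots$ (variables and parameters together are called atoms), the constant $\bot$, the binary connectives $\wedge,\vee,\to$ and the unary modality $\Box$. Put $\neg A:=A\to\bot$, $\top:=\bot\to\bot$, $\boxdot A:=A\wedge\Box A$. Let $\mathsf{parb}$ be the set consisting of $\bot$, all parameters, and all formulas of the form $\Box B$; let $\mathsf{atomb}:=\mathsf{parb}\cup\{\text{variables}\}$. For a set $X$ of formulas, $\mathcal L_0(X)$ is the least set containing $X\cup\{\bot\}$ and closed under $\wedge,\vee,\to$; for a set $\Gamma$ of formulas, $\Gamma(X):=\Gamma\cap\mathcal L_0(X)$ and $\Gamma(\Box):=\Gamma(\mathsf{parb})$. Logics. $\mathsf{iK4}$ is the least set of $\mathcal L_\Box$-formulas closed under modus ponens that contains every instance of the axiom schemata of intuitionistic propositional logic $\mathsf{IPC}$, of $\Box(A\to B)\to(\Box A\to\Box B)$, of $\Box A\to\Box\Box A$, and of $p\to\Box p$ for every parameter $p$, together with $\Box\varphi$ for every such instance $\varphi$ (hence it is closed under necessitation). $\mathsf{iGL}$ is defined in the same way with, in addition, the Löb schema $\Box(\Box A\to A)\to\Box A$ (and its boxed instances). $\mathsf{iK4C_a}$, $\mathsf{iGLC_a}$ are obtained from $\mathsf{iK4}$,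 $\mathsf{iGL}$ by adding the axioms $a\to\Box a$ for all atoms $a$ together with their boxed instances. In general a logic $T$ is a set of formulas containing $\mathsf{IPC}$ and closed under modus ponens; $T\vdash A$ means $A\in T$. Substitutions. A substitution $\theta$ assigns a formula to each variable and is the identity on parameters; it is extended to all formulas by fixing $\bot$ and commuting with $\wedge,\vee,\to,\Box$. Box translation. $x^\Box:=\boxdot x$ for variables $x$; $A^\Box:=A$ for $A\in\mathsf{parb}$; $(B\circ C)^\Box:=B^\Box\circ C^\Box$ for $\circ\in\{\wedge,\vee\}$; $(B\to C)^\Box:=\boxdot(B^\Box\to C^\Box)$. Let $\mathsf S:=\{B^\Box:B\in\mathcal L_\Box\}$. NNIL. The classes $\mathsf{NI}$ and $\mathsf{NNIL}$ are the least sets of formulas such that every element of $\mathsf{atomb}$ belongs to both, both are closed under $\wedge$ and $\vee$, and $B\to C\in\mathsf{NNIL}$ whenever $B\in\mathsf{NI}$ and $C\in\mathsf{NNIL}$. Thus $\mathsf{NNIL}(\Box)=\mathsf{NNIL}\cap\mathcal L_0(\mathsf{parb})$. Preservativity. For a logic $T$ and a set $\Gamma$ of formulas, $A\rhd^{\Gamma}_{T}B$ means: for every $E\in\Gamma$, $T\vdash E\to A$ implies $T\vdash E\to B$. The logic $\mathsf{iGLH^\Box}$ is the least set of formulas closed under modus ponens containing $\mathsf{iGL}$ and, for all $A,B$ with $A\rhd^{\mathsf S\cap\mathsf{NNIL}(\Box)}_{\mathsf{iGL}}B$, the formulas $\Box A\to\Box B$ and $\Box(\Box A\to\Box B)$.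 The logic $\mathsf{iGLC_aH_\sigma}$ is the least set of formulas closed under modus ponens containing $\mathsf{iGLC_a}$ and, for all $A,B$ with $A\rhd^{\mathsf S\cap\mathsf{NNIL}}_{\mathsf{iGLC_a}}B$, the formulas $\Box A\to\Box B$ and $\Box(\Box A\to\Box B)$. *)

(* Defs.v *)
Inductive form : Type :=
| Var : nat -> form
| Par : nat -> form
| Bot : form
| And : form -> form -> form
| Or  : form -> form -> form
| Imp : form -> form -> form
| Box : form -> form.

Definition Neg (A : form) : form := Imp A Bot.
Definition Top : form := Imp Bot Bot.
Definition Boxdot (A : form) : form := And A (Box A).

Definition parb (A : form) : Prop :=
  match A with
  | Bot | Par _ | Box _ => True
  | _ => False
  end.

Definition atomb (A : form) : Prop :=
  match A with
  | Var _ => True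
  | _ => parb A
  end.

Inductive L0 (X : form -> Prop) : form -> Prop :=
| L0_in  : forall A, X A -> L0 X A
| L0_bot : L0 X Bot
| L0_and : forall A B, L0 X A -> L0 X B -> L0 X (And A B)
| L0_or  : forall A B, L0 X A -> L0 X B -> L0 X (Or A B)
| L0_imp : forall A B, L0 X A -> L0 X B -> L0 X (Imp A B).

Fixpoint subst (theta : nat -> form) (A : form) : form :=
  match A with
  | Var n => theta n
  | Par n => Par n
  | Bot => Bot
  | And B C => And (subst theta B) (subst theta C)
  | Or B C => Or (subst theta B) (subst theta C)
  | Imp B C => Imp (subst theta B) (subst theta C)
  | Box B => Box (subst theta B)
  end.

Fixpoint boxtr (A : form) : form :=
  match A with
  | Var n => Boxdot (Var n)
  | Par n => Par n
  | Bot => Bot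
  | Box B => Box B
  | And B C => And (boxtr B) (boxtr C)
  | Or B C => Or (boxtr B) (boxtr C)
  | Imp B C => Boxdot (Imp (boxtr B) (boxtr C))
  end.

Definition inS (E : form) : Prop := exists B, E = boxtr B.

Inductive NI : form -> Prop :=
| NI_at  : forall A, atomb A -> NI A
| NI_and : forall A B, NI A -> NI B -> NI (And A B)
| NI_or  : forall A B, NI A -> NI B -> NI (Or A B).

Inductive NNIL : form -> Prop :=
| NNIL_at  : forall A, atomb A -> NNIL A
| NNIL_and : forall A B, NNIL A -> NNIL B -> NNIL (And A B)
| NNIL_or  : forall A B, NNIL A -> NNIL B -> NNIL (Or A B)
| NNIL_imp : forall A B, NI A -> NNIL B -> NNIL (Imp A B).

Definition NNILbox (A : form) : Prop := NNIL A /\ L0 parb A.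

Inductive IPC_ax : form -> Prop :=
| ax_K1 : forall A B, IPC_ax (Imp A (Imp B A))
| ax_S  : forall A B C,
    IPC_ax (Imp (Imp A (Imp B C)) (Imp (Imp A B) (Imp A C)))
| ax_andE1 : forall A B, IPC_ax (Imp (And A B) A)
| ax_andE2 : forall A B, IPC_ax (Imp (And A B) B)
| ax_andI  : forall A B, IPC_ax (Imp A (Imp B (And A B)))
| ax_orI1  : forall A B, IPC_ax (Imp A (Or A B))
| ax_orI2  : forall A B, IPC_ax (Imp B (Or A B))
| ax_orE   : forall A B C,
    IPC_ax (Imp (Imp A C) (Imp (Imp B C) (Imp (Or A B) C)))
| ax_efq   : forall A, IPC_ax (Imp Bot A).

Inductive iK4_ax : form -> Prop :=
| k4_ipc : forall A, IPC_ax A -> iK4_ax A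
| k4_K : forall A B, iK4_ax (Imp (Box (Imp A B)) (Imp (Box A) (Box B)))
| k4_4 : forall A, iK4_ax (Imp (Box A) (Box (Box A)))
| k4_par : forall n, iK4_ax (Imp (Par n) (Box (Par n))).

Inductive iGL_ax : form -> Prop :=
| gl_k4 : forall A, iK4_ax A -> iGL_ax A
| gl_lob : forall A, iGL_ax (Imp (Box (Imp (Box A) A)) (Box A)).

Inductive Ca_ax : form -> Prop :=
| ca_var : forall n, Ca_ax (Imp (Var n) (Box (Var n)))
| ca_par : forall n, Ca_ax (Imp (Par n) (Box (Par n))).

Definition iGLCa_ax (A : form) : Prop := iGL_ax A \/ Ca_ax A.

Inductive derivable (Ax : form -> Prop) : form -> Prop :=
| d_ax  : forall A, Ax A -> derivable Ax A
| d_bax : forall A, Ax A -> derivable Ax (Box A)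
| d_mp  : forall A B, derivable Ax (Imp A B) -> derivable Ax A -> derivable Ax B.

Definition iGL (A : form) : Prop := derivable iGL_ax A.
Definition iGLCa (A : form) : Prop := derivable iGLCa_ax A.

Definition pres (T : form -> Prop) (Gamma : form -> Prop) (A B : form) : Prop :=
  forall E, Gamma E -> T (Imp E A) -> T (Imp E B).

Inductive iGLHbox : form -> Prop :=
| hb_iGL : forall A, iGL A -> iGLHbox A
| hb_pres : forall A B,
    pres iGL (fun E => inS E /\ NNILbox E) A B ->
    iGLHbox (Imp (Box A) (Box B))
| hb_bpres : forall A B,
    pres iGL (fun E => inS E /\ NNILbox E) A B ->
    iGLHbox (Box (Imp (Box A) (Box B)))
| hb_mp : forall A B, iGLHbox (Imp A B) -> iGLHbox A -> iGLHbox B.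

Inductive iGLCaHsigma : form -> Prop :=
| hs_iGLCa : forall A, iGLCa A -> iGLCaHsigma A
| hs_pres : forall A B,
    pres iGLCa (fun E => inS E /\ NNIL E) A B ->
    iGLCaHsigma (Imp (Box A) (Box B))
| hs_bpres : forall A B,
    pres iGLCa (fun E => inS E /\ NNIL E) A B ->
    iGLCaHsigma (Box (Imp (Box A) (Box B)))
| hs_mp : forall A B, iGLCaHsigma (Imp A B) -> iGLCaHsigma A -> iGLCaHsigma B.

(* Main.v *)
From Stdlib Require Import List Lia Arith Cantor Classical ClassicalEpsilon.
Require Import Defs.
Import ListNotations.

(** Work in the canonical model of [iGLHbox]: worlds are prime theories, ordered by
    inclusion, and a successor must make strictly more of the parameters and boxed
    subformulas of [A] true. On the same worlds define a model of [iGLCaHsigma] by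
    letting [Box B] hold at [w] iff every successor of [w] forces some [E] in
    S and NNIL with [iGLCa |- E -> B]; soundness of the preservativity axioms is
    then immediate, and that of the remaining axioms only uses [E -> Box E].

    Since the number [r] of true parameters and boxes grows strictly along
    successors, an arbitrary variable [x] is definable from persistent ones: [x] is
    the conjunction over [k] of [(r >= k) -> (r > k or (r = k and x))]. This gives
    the substitution, and it preserves truth of all subformulas of [A]. For boxed
    ones the nontrivial direction needs that, for every [B], there are
    finitely many NNIL formulas over the parameters and boxes of [A] whose box
    translations imply [B] in [iGL] and whose disjunction [D] satisfies [B |> D]. *)

(** * Normal extensions of [iGL] *)

Record normal (L : form -> Prop) : Prop := {
  normal_iGL : forall A, iGL A -> L A;
  normal_mp : forall A B, L (Imp A B) -> L A -> L B;
  normal_nec : forall A, L A -> L (Box A) }.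

Lemma derivable_nec (Ax : form -> Prop) :
  (forall A, iGL_ax A -> Ax A) ->
  forall A, derivable Ax A -> derivable Ax (Box A).
Proof.
  intros H A D. induction D as [A HA | A HA | A B _ IH1 _ IH2].
  - now apply d_bax.
  - apply d_mp with (Box A); [| now apply d_bax].
    apply d_ax, H, gl_k4, k4_4.
  - apply d_mp with (Box A); [| exact IH2].
    apply d_mp with (Box (Imp A B)); [| exact IH1].
    apply d_ax, H, gl_k4, k4_K.
Qed.

Lemma derivable_mono (Ax Ax' : form -> Prop) :
  (forall A, Ax A -> Ax' A) -> forall A, derivable Ax A -> derivable Ax' A.
Proof.
  intros H A D. induction D; [apply d_ax | apply d_bax | eapply d_mp]; eauto.
Qed.

Lemma normal_derivable (Ax : form -> Prop) :
  (forall A, iGL_ax A -> Ax A) -> normal (derivable Ax).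
Proof.
  intros H. split.
  - now apply derivable_mono.
  - intros A B. apply d_mp.
  - now apply derivable_nec.
Qed.

Lemma iGL_normal : normal iGL.
Proof. apply normal_derivable; auto. Qed.

Lemma iGLCa_normal : normal iGLCa.
Proof. apply normal_derivable; intros A H; now left. Qed.

(** Necessitation survives the preservativity axioms because their boxed forms are axioms too; an
    already boxed one is boxed again by transitivity. *)
Lemma iGLHbox_normal : normal iGLHbox.
Proof.
  split.
  - exact hb_iGL.
  - exact hb_mp.
  - intros A D. induction D as [A HA | A B HP | A B HP | A B _ IH1 _ IH2].
    + apply hb_iGL, (normal_nec _ iGL_normal), HA.
    + now apply hb_bpres.
    + apply hb_mp with (Box (Imp (Box A) (Box B))); [| now apply hb_bpres].
      apply hb_iGL, d_ax, gl_k4, k4_4.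
    + apply hb_mp with (Box A); [| exact IH2].
      apply hb_mp with (Box (Imp A B)); [| exact IH1].
      apply hb_iGL, d_ax, gl_k4, k4_K.
Qed.

Lemma normal_ipc L A : normal L -> IPC_ax A -> L A.
Proof. intros N H. apply (normal_iGL _ N), d_ax, gl_k4, k4_ipc, H. Qed.

(** * Prime theories *)

Inductive ded (L X : form -> Prop) : form -> Prop :=
| ded_logic : forall A, L A -> ded L X A
| ded_hyp : forall A, X A -> ded L X A
| ded_mp : forall A B, ded L X (Imp A B) -> ded L X A -> ded L X B.

Lemma ded_mono L (X Y : form -> Prop) A :
  (forall B, X B -> Y B) -> ded L X A -> ded L Y A.
Proof.
  intros H D. induction D;
    [apply ded_logic | apply ded_hyp | eapply ded_mp]; eauto.
Qed.

Lemma ded_intro L X A B : normal L ->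
  ded L (fun C => X C \/ C = A) B -> ded L X (Imp A B).
Proof.
  intros N D. induction D as [B HB | B [HB | ->] | B C _ IH1 _ IH2].
  - apply ded_mp with B; [apply ded_logic, normal_ipc, ax_K1; exact N |].
    now apply ded_logic.
  - apply ded_mp with B; [apply ded_logic, normal_ipc, ax_K1; exact N |].
    now apply ded_hyp.
  - apply ded_mp with (Imp A (Imp A A));
      [apply ded_mp with (Imp A (Imp (Imp A A) A)) |];
      apply ded_logic, normal_ipc; try exact N; constructor.
  - apply ded_mp with (Imp A B); [| exact IH2].
    apply ded_mp with (Imp A (Imp B C)); [| exact IH1].
    apply ded_logic, normal_ipc; [exact N | constructor].
Qed.

Lemma ded_empty L A : normal L -> ded L (fun _ => False) A -> L A.
Proof.
  intros N D. induction D; [assumption | contradiction |].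
  eapply normal_mp; eauto.
Qed.

Record prime (L G : form -> Prop) : Prop := {
  prime_logic : forall A, L A -> G A;
  prime_mp : forall A B, G (Imp A B) -> G A -> G B;
  prime_bot : ~ G Bot;
  prime_or : forall A B, G (Or A B) -> G A \/ G B }.

(** A code pairs a constructor tag with a payload. The fuel [f] makes the recursion structural and
    becomes part of the number in [enum]; the threshold in [decode_surj] lets subformulas with
    different needs share one fuel. *)
Fixpoint decode (f n : nat) : form :=
  match f with
  | 0 => Bot
  | S f =>
    let (t, m) := of_nat n in
    let (a, b) := of_nat m in
    match t with
    | 0 => Bot
    | 1 => Var m
    | 2 => Par m
    | 3 => And (decode f a) (decode f b)
    | 4 => Or (decode f a) (decode f b)
    | 5 => Imp (decode f a) (decode f b)
    | _ => Box (decode f m)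
    end
  end.

Lemma decode_surj A : exists n f0, forall f, f0 <= f -> decode f n = A.
Proof.
  assert (E : forall t m f, decode (S f) (to_nat (t, m)) =
    let (a, b) := of_nat m in
    match t with
    | 0 => Bot | 1 => Var m | 2 => Par m
    | 3 => And (decode f a) (decode f b)
    | 4 => Or (decode f a) (decode f b)
    | 5 => Imp (decode f a) (decode f b)
    | _ => Box (decode f m)
    end).
  { intros t m f. cbn [decode]. now rewrite cancel_of_to. }
  induction A as [n | n | | A [n1 [f1 H1]] B [n2 [f2 H2]]
                 | A [n1 [f1 H1]] B [n2 [f2 H2]]
                 | A [n1 [f1 H1]] B [n2 [f2 H2]] | A [n1 [f1 H1]]].
  - exists (to_nat (1, n)), 1. intros [| f] Hf; [lia |]. rewrite E.
    now destruct (of_nat n).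
  - exists (to_nat (2, n)), 1. intros [| f] Hf; [lia |]. rewrite E.
    now destruct (of_nat n).
  - exists 0, 0. intros [| f] Hf; reflexivity.
  - exists (to_nat (3, to_nat (n1, n2))), (S (f1 + f2)).
    intros [| f] Hf; [lia |]. rewrite E, cancel_of_to, H1, H2 by lia. reflexivity.
  - exists (to_nat (4, to_nat (n1, n2))), (S (f1 + f2)).
    intros [| f] Hf; [lia |]. rewrite E, cancel_of_to, H1, H2 by lia. reflexivity.
  - exists (to_nat (5, to_nat (n1, n2))), (S (f1 + f2)).
    intros [| f] Hf; [lia |]. rewrite E, cancel_of_to, H1, H2 by lia. reflexivity.
  - exists (to_nat (6, n1)), (S f1).
    intros [| f] Hf; [lia |]. rewrite E, H1 by lia. now destruct (of_nat n1).
Qed.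

Definition enum (n : nat) : form := let (f, m) := of_nat n in decode f m.

Lemma enum_surj A : exists n, enum n = A.
Proof.
  destruct (decode_surj A) as [m [f H]].
  exists (to_nat (f, m)). unfold enum. rewrite cancel_of_to. auto.
Qed.

Fixpoint stage (L X : form -> Prop) (C : form) (n : nat) : form -> Prop :=
  match n with
  | 0 => X
  | S n => fun A => stage L X C n A \/
      (A = enum n /\ ~ ded L (fun B => stage L X C n B \/ B = enum n) C)
  end.

Lemma stage_le L X C n m A : n <= m -> stage L X C n A -> stage L X C m A.
Proof. induction 1; [auto | left; auto]. Qed.

Lemma stage_consistent L X C n : ~ ded L X C -> ~ ded L (stage L X C n) C.
Proof.
  intros H. induction n as [| n IH]; [exact H |]. intros D.
  destruct (classic (ded L (fun B => stage L X C n B \/ B = enum n) C)) as [K | K].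
  - apply IH. revert D. apply ded_mono. intros B [HB | [_ HB]]; tauto.
  - apply K. revert D. apply ded_mono. intros B [HB | [HB _]]; tauto.
Qed.

Lemma ded_stage L X C A :
  ded L (fun B => exists n, stage L X C n B) A -> exists n, ded L (stage L X C n) A.
Proof.
  intros D. induction D as [A H | A [n H] | A B _ [n IH1] _ [m IH2]].
  - exists 0. now apply ded_logic.
  - exists n. now apply ded_hyp.
  - exists (n + m). apply ded_mp with A.
    + revert IH1. apply ded_mono. intros D. apply stage_le. lia.
    + revert IH2. apply ded_mono. intros D. apply stage_le. lia.
Qed.

(** [G] is maximal among the extensions of [X] not deriving [C], so every formula outside [G]
    implies [C] over [G]. A disjunction in [G] with both disjuncts outside would then derive [C],
    which gives primeness. *)
Lemma lindenbaum L X C : normal L -> ~ ded L X C ->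
  exists G, prime L G /\ (forall A, X A -> G A) /\ ~ G C.
Proof.
  intros N H. set (G := fun B => exists n, stage L X C n B).
  assert (Hcons : ~ ded L G C).
  { intros D. destruct (ded_stage _ _ _ _ D) as [n K].
    exact (stage_consistent _ _ _ n H K). }
  assert (Hmax : forall A, ~ G A -> ded L G (Imp A C)).
  { intros A HA. apply ded_intro; [exact N |].
    destruct (enum_surj A) as [n <-].
    apply NNPP. intros K. apply HA. exists (S n). right. split; [reflexivity |].
    intros D. apply K. revert D. apply ded_mono.
    intros B [HB | HB]; [left; now exists n | now right]. }
  assert (Hclos : forall A, ded L G A -> G A).
  { intros A D. apply NNPP. intros K. apply Hcons.
    apply ded_mp with A; auto. }
  exists G. split; [split |].
  - intros A HA. now apply Hclos, ded_logic.
  - intros A B H1 H2. apply Hclos, ded_mp with A; now apply ded_hyp.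
  - intros K. apply Hcons. apply ded_mp with Bot; [| now apply ded_hyp].
    apply ded_logic, normal_ipc; [exact N | constructor].
  - intros A B HAB. apply NNPP. intros K. apply Hcons.
    apply ded_mp with (Or A B); [| now apply ded_hyp].
    apply ded_mp with (Imp B C); [| apply Hmax; tauto].
    apply ded_mp with (Imp A C); [| apply Hmax; tauto].
    apply ded_logic, normal_ipc; [exact N | constructor].
  - split.
    + intros A HA. now exists 0.
    + intros K. now apply Hcons, ded_hyp.
Qed.

Lemma prime_complete L A : normal L -> (forall G, prime L G -> G A) -> L A.
Proof.
  intros N H. apply NNPP. intros K.
  destruct (lindenbaum L (fun _ => False) A N) as [G [PG [_ HG]]].
  - intros D. now apply K, ded_empty.
  - now apply HG, H.
Qed.

Lemma prime_imp L G A B : normal L -> prime L G ->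
  (forall D, prime L D -> (forall C, G C -> D C) -> D A -> D B) -> G (Imp A B).
Proof.
  intros N PG H. apply NNPP. intros K.
  destruct (lindenbaum L (fun C => G C \/ C = A) B N) as [D [PD [HD HB]]].
  - intros D. apply K.
    apply ded_intro in D; [| exact N].
    assert (HG : forall C, ded L G C -> G C).
    { intros C HC. induction HC; auto; [now apply (prime_logic L G) |].
      eapply prime_mp; eauto. }
    auto.
  - apply HB, H; auto.
Qed.

(** Replaces explicit Hilbert derivations below: an implication is proved by reasoning inside an
    arbitrary prime theory. *)
Lemma prime_implies L A B : normal L ->
  (forall G, prime L G -> G A -> G B) -> L (Imp A B).
Proof.
  intros N H. apply prime_complete; [exact N |]. intros G PG.
  apply (prime_imp L); [exact N | exact PG |].
  intros D PD _. exact (H D PD).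
Qed.

Lemma prime_ipc L G A : normal L -> prime L G -> IPC_ax A -> G A.
Proof. intros N PG H. now apply (prime_logic L), normal_ipc. Qed.

Lemma prime_iGL L G A : normal L -> prime L G -> iGL_ax A -> G A.
Proof. intros N PG H. now apply (prime_logic L), (normal_iGL L N), d_ax. Qed.

Lemma prime_and L G A B : normal L -> prime L G -> (G (And A B) <-> G A /\ G B).
Proof.
  intros N PG. split.
  - intros H. split; eapply (prime_mp L); try exact H; try exact PG;
      eapply prime_ipc; eauto; constructor.
  - intros [H1 H2]. apply (prime_mp L G PG B); [| exact H2].
    apply (prime_mp L G PG A); [| exact H1]. eapply prime_ipc; eauto; constructor.
Qed.

Lemma prime_or_iff L G A B : normal L -> prime L G -> (G (Or A B) <-> G A \/ G B).
Proof.
  intros N PG. split; [apply (prime_or L G PG) |].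
  intros [H | H]; eapply (prime_mp L); try exact H; try exact PG;
    eapply prime_ipc; eauto; constructor.
Qed.

Lemma prime_box2 L G A B C : normal L -> prime L G ->
  L (Imp A (Imp B C)) -> G (Box A) -> G (Box B) -> G (Box C).
Proof.
  intros N PG H HA HB. apply (prime_mp L G PG (Box B)); [| exact HB].
  apply (prime_mp L G PG (Box (Imp B C))).
  { eapply prime_iGL; eauto. apply gl_k4, k4_K. }
  apply (prime_mp L G PG (Box A)); [| exact HA].
  apply (prime_mp L G PG (Box (Imp A (Imp B C)))).
  { eapply prime_iGL; eauto. apply gl_k4, k4_K. }
  now apply (prime_logic L), normal_nec.
Qed.

Lemma prime_box1 L G A B : normal L -> prime L G ->
  L (Imp A B) -> G (Box A) -> G (Box B).
Proof.
  intros N PG H HA. apply (prime_mp L G PG (Box A)); [| exact HA].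
  apply (prime_mp L G PG (Box (Imp A B))).
  { eapply prime_iGL; eauto. apply gl_k4, k4_K. }
  now apply (prime_logic L), normal_nec.
Qed.

Lemma prime_4 L G A : normal L -> prime L G -> G (Box A) -> G (Box (Box A)).
Proof.
  intros N PG H. apply (prime_mp L G PG (Box A)); [| exact H].
  eapply prime_iGL; eauto. apply gl_k4, k4_4.
Qed.

Lemma prime_lob L G A : normal L -> prime L G ->
  G (Box (Imp (Box A) A)) -> G (Box A).
Proof.
  intros N PG. apply (prime_mp L G PG).
  eapply prime_iGL; eauto. apply gl_lob.
Qed.

Lemma prime_parb L G q : normal L -> prime L G -> parb q -> G q -> G (Box q).
Proof.
  intros N PG Hq H. destruct q as [n | n | | A B | A B | A B | A];
    try contradiction.
  - apply (prime_mp L G PG (Par n)); [| exact H].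
    eapply prime_iGL; eauto. apply gl_k4, k4_par.
  - destruct (prime_bot L G PG H).
  - eapply prime_4; eauto.
Qed.

(** The translation guards variables and implications by [Boxdot], and [Boxdot A] yields its own box
    by transitivity. Boxes, parameters and [Bot] are covered by [prime_parb]. *)
Lemma prime_boxtr L G B : normal L -> prime L G ->
  G (boxtr B) -> G (Box (boxtr B)).
Proof.
  intros N PG.
  assert (Hbd : forall A, G (Boxdot A) -> G (Box (Boxdot A))).
  { unfold Boxdot. intros A H. apply (prime_and L G) in H as [_ H]; auto.
    apply (prime_box2 L G A (Box A)); auto.
    - apply normal_ipc; [exact N | constructor].
    - now apply (prime_4 L). }
  induction B as [n | n | | B1 IH1 B2 IH2 | B1 IH1 B2 IH2 | B1 IH1 B2 IH2 | B IH];
    cbn [boxtr]; auto.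
  1, 2, 5: apply (prime_parb L); simpl; auto.
  - intros H. apply (prime_and L G) in H as [H1 H2]; auto.
    apply (prime_box2 L G (boxtr B1) (boxtr B2)); auto.
    apply normal_ipc; [exact N | constructor].
  - intros H. apply (prime_or_iff L G) in H as [H | H]; auto.
    + apply (prime_box1 L G (boxtr B1)); auto.
      apply normal_ipc; [exact N | constructor].
    + apply (prime_box1 L G (boxtr B2)); auto.
      apply normal_ipc; [exact N | constructor].
Qed.

Lemma prime_box L G B : normal L -> prime L G -> ~ G (Box B) ->
  exists D, prime L D /\ (forall C, G (Box C) -> D C) /\ ~ D B.
Proof.
  intros N PG H. apply (lindenbaum L (fun C => G (Box C)) B N).
  intros D. apply H. induction D as [A HA | A HA | A C _ IH1 _ IH2]; auto.
  - now apply (prime_logic L), normal_nec.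
  - apply (prime_mp L G PG (Box A)); [| tauto].
    apply (prime_mp L G PG (Box (Imp A C))); [| tauto].
    eapply prime_iGL; eauto. apply gl_k4, k4_K.
Qed.

(** * Kripke forcing *)

(** Boxed formulas are read off [val] like atoms, so each model can give [Box] its own meaning on
    top of a purely intuitionistic frame. *)
Fixpoint force {W : Type} (le : W -> W -> Prop) (val : W -> form -> Prop)
  (w : W) (A : form) : Prop :=
  match A with
  | Bot => False
  | And B C => force le val w B /\ force le val w C
  | Or B C => force le val w B \/ force le val w C
  | Imp B C => forall v, le w v -> force le val v B -> force le val v C
  | _ => val w A
  end.

Record kripke {W : Type} (le : W -> W -> Prop) (val : W -> form -> Prop) : Prop := {
  kripke_refl : forall w, le w w;
  kripke_trans : forall u v w, le u v -> le v w -> le u w;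
  kripke_val : forall w v A, le w v -> val w A -> val v A }.

Lemma force_mono {W} le (val : W -> form -> Prop) A : kripke le val ->
  forall w v, le w v -> force le val w A -> force le val v A.
Proof.
  intros K. induction A; cbn [force]; intros w v H; try tauto.
  - now apply (kripke_val _ _ K).
  - now apply (kripke_val _ _ K).
  - intros [H1 H2]; eauto.
  - intros [H1 | H2]; eauto.
  - intros HI u Hu. apply HI. eapply (kripke_trans _ _ K); eauto.
  - now apply (kripke_val _ _ K).
Qed.

Lemma force_ipc {W} le (val : W -> form -> Prop) A : kripke le val ->
  IPC_ax A -> forall w, force le val w A.
Proof.
  intros K H w. pose proof (kripke_refl _ _ K) as R.
  assert (M : forall A w v, le w v -> force le val w A -> force le val v A)
    by (intros; eapply force_mono; eauto).
  assert (T := kripke_trans _ _ K).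
  destruct H; cbn [force].
  - intros v _ HA u Hu _. eauto.
  - intros v1 H1 HA v2 H2 HB v3 H3 HC. apply (HA v3); eauto.
  - tauto.
  - tauto.
  - intros v1 H1 HA v2 H2 HB. split; eauto.
  - tauto.
  - tauto.
  - intros v1 H1 HA v2 H2 HB v3 H3 [HC | HC]; eauto.
  - tauto.
Qed.

Lemma force_ext {W} (le : W -> W -> Prop) (val val' : W -> form -> Prop) A :
  (forall u v w, le u v -> le v w -> le u w) ->
  forall w, le w w ->
  (forall v B, le w v -> (val v B <-> val' v B)) ->
  (forall v, le w v -> le v v) ->
  (force le val w A <-> force le val' w A).
Proof.
  intros T. induction A; cbn [force]; intros w Hw E R; try (now apply E); try tauto.
  - rewrite (IHA1 w), (IHA2 w); tauto.
  - rewrite (IHA1 w), (IHA2 w); tauto.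
  - split; intros H v Hv HA.
    + apply (IHA2 v); eauto. apply H; [exact Hv |]. apply (IHA1 v); eauto.
    + apply (IHA2 v); eauto. apply H; [exact Hv |]. apply (IHA1 v); eauto.
Qed.

(** * NNIL approximations *)

(** Repetitions in [l] are counted each time; this affects neither monotonicity nor the bound by
    [length l]. *)
Fixpoint cnt (l : list form) (G : form -> Prop) : nat :=
  match l with
  | [] => 0
  | q :: l => (if excluded_middle_informative (G q) then 1 else 0) + cnt l G
  end.

Lemma cnt_length l G : cnt l G <= length l.
Proof. induction l; simpl; [lia |]. destruct excluded_middle_informative; lia. Qed.

Lemma cnt_le l (G D : form -> Prop) :
  (forall q, In q l -> G q -> D q) -> cnt l G <= cnt l D.
Proof.
  induction l as [| q l IH]; simpl; intros H; [lia |].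
  assert (cnt l G <= cnt l D) by (apply IH; auto).
  destruct (excluded_middle_informative (G q)), (excluded_middle_informative (D q));
    try lia. exfalso; auto.
Qed.

Lemma cnt_lt l (G D : form -> Prop) p :
  (forall q, In q l -> G q -> D q) -> In p l -> ~ G p -> D p -> cnt l G < cnt l D.
Proof.
  induction l as [| q l IH]; simpl; intros H Hp HG HD; [contradiction |].
  assert (cnt l G <= cnt l D) by (apply cnt_le; auto).
  destruct Hp as [-> | Hp].
  - destruct (excluded_middle_informative (G p)), (excluded_middle_informative (D p));
      try lia; tauto.
  - assert (cnt l G < cnt l D) by (apply IH; auto).
    destruct (excluded_middle_informative (G q)), (excluded_middle_informative (D q));
      try lia. exfalso; auto.
Qed.

Fixpoint sublists (l : list form) : list (list form) :=
  match l with
  | [] => [[]]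
  | a :: l => sublists l ++ map (cons a) (sublists l)
  end.

Lemma sublists_spec (Q : form -> Prop) l :
  exists l', In l' (sublists l) /\ forall a, In a l' <-> In a l /\ Q a.
Proof.
  induction l as [| b l [l' [H1 H2]]]; simpl.
  - exists []. split; [now left |]. simpl. tauto.
  - destruct (classic (Q b)) as [Hb | Hb].
    + exists (b :: l'). split.
      * apply in_or_app. right. now apply in_map.
      * intros a. simpl. rewrite H2. split; [intros [<- | ?] |]; tauto.
    + exists l'. split; [apply in_or_app; now left |].
      intros a. rewrite H2. split; [tauto |]. intros [[<- | ?] ?]; tauto.
Qed.

Definition conj (l : list form) : form := fold_right And Top l.
Definition disj (l : list form) : form := fold_right Or Bot l.

Lemma prime_top L G : normal L -> prime L G -> G (boxtr Top).
Proof.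
  intros N PG. assert (HT : L (Imp Bot Bot)).
  { apply normal_ipc; [exact N | apply ax_efq]. }
  apply (prime_and L G); auto.
  split; apply (prime_logic L G PG); [exact HT | now apply normal_nec].
Qed.

Lemma prime_conj L G l : normal L -> prime L G ->
  (G (boxtr (conj l)) <-> forall A, In A l -> G (boxtr A)).
Proof.
  intros N PG. induction l as [| B l IH].
  - split; [intros _ A [] | intros _; exact (prime_top L G N PG)].
  - change (boxtr (conj (B :: l))) with (And (boxtr B) (boxtr (conj l))).
    rewrite (prime_and L G), IH by auto. split.
    + intros [H1 H2] A [<- | H]; auto.
    + intros H. split; [| intros A HA]; apply H; simpl; auto.
Qed.

Lemma prime_disj L G l : normal L -> prime L G ->
  (G (disj l) <-> exists A, In A l /\ G A).
Proof.
  intros N PG. induction l as [| B l IH].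
  - split; [intros H; destruct (prime_bot L G PG H) | intros [A [[] _]]].
  - change (disj (B :: l)) with (Or B (disj l)).
    rewrite (prime_or_iff L G), IH by auto. split.
    + intros [H | [A [H1 H2]]]; [exists B | exists A]; simpl; auto.
    + intros [A [[<- | H1] H2]]; eauto.
Qed.

Lemma boxtr_disj l : boxtr (disj l) = disj (map boxtr l).
Proof. induction l as [| B l IH]; [reflexivity |]. simpl. now f_equal. Qed.

(* The accessibility that formulas of the form [boxtr B] persist along. *)
Definition reach (G D : form -> Prop) : Prop :=
  forall C, G C -> G (Box C) -> D C.

Lemma reach_box L G D C : normal L -> prime L G -> reach G D ->
  G (Box C) -> D (Box C).
Proof. intros N PG H HC. apply H; [exact HC | now apply (prime_4 L)]. Qed.

Lemma reach_trans L G D E : normal L -> prime L G ->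
  reach G D -> reach D E -> reach G E.
Proof.
  intros N PG H1 H2 C HC HB. apply H2; [now apply H1 |].
  now apply (reach_box L G).
Qed.

Lemma reach_parb L G D q : normal L -> prime L G -> reach G D ->
  parb q -> G q -> D q.
Proof. intros N PG H Hq HG. apply H; [exact HG | now apply (prime_parb L)]. Qed.

(* [char P k G f]: the NNIL formula [f] holds exactly at those Kripke nodes whose
   upper cone maps monotonically into the [reach]-cone of [G], preserving the
   truth values of the atoms in [P]; [k] bounds the number of changes in [P]. *)
Fixpoint char (P : list form) (k : nat) (G : form -> Prop) (f : form) : Prop :=
  match k with
  | 0 => False
  | S k => exists V U T,
      f = And (conj V) (conj (map (fun q => Imp q (disj T)) U)) /\
      (forall q, In q V <-> In q P /\ G q) /\
      (forall q, In q U <-> In q P /\ ~ G q) /\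
      (forall g, In g T -> exists D, prime iGL D /\ reach G D /\ char P k D g) /\
      (forall D, prime iGL D -> reach G D -> cnt P G < cnt P D ->
         exists g, In g T /\ char P k D g)
  end.

(** One finite list serves all [G]: at each level a formula is fixed by two sublists of [P] and a
    sublist of the previous list. The inequality says that [k] exceeds the number of atoms of [P]
    still false in [G], so level 0 is never reached. *)
Lemma char_exists P k : exists l, forall G, prime iGL G ->
  length P < k + cnt P G -> exists f, In f l /\ char P k G f.
Proof.
  induction k as [| k [l IH]].
  - exists []. intros G _ H. pose proof (cnt_length P G). lia.
  - exists (map (fun x => And (conj (fst x))
                  (conj (map (fun q => Imp q (disj (snd (snd x)))) (fst (snd x)))))
             (list_prod (sublists P) (list_prod (sublists P) (sublists l)))).
    intros G PG H.
    destruct (sublists_spec G P) as [V [V1 V2]].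
    destruct (sublists_spec (fun q => ~ G q) P) as [U [U1 U2]].
    destruct (sublists_spec (fun g => exists D,
      prime iGL D /\ reach G D /\ char P k D g) l) as [T [T1 T2]].
    exists (And (conj V) (conj (map (fun q => Imp q (disj T)) U))). split.
    + apply in_map_iff. exists (V, (U, T)). split; [reflexivity |].
      now repeat apply in_prod.
    + exists V, U, T. split; [reflexivity |]. split; [exact V2 |].
      split; [exact U2 |]. split.
      * intros g Hg. now apply T2.
      * intros D PD HR Hlt. destruct (IH D PD) as [g [G1 G2]]; [lia |].
        exists g. split; [| exact G2]. apply T2. split; [exact G1 | now exists D].
Qed.

(** [G] contains its own characteristic formula: an atom false in [G] can become true only at a
    [reach]-successor with larger count, whose characteristic formula is a disjunct of [T]. *)
Lemma char_mem P k : (forall q, In q P -> parb q) ->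
  forall G f, prime iGL G -> char P k G f -> G (boxtr f).
Proof.
  intros HP. pose proof iGL_normal as N.
  assert (Hb : forall q, In q P -> boxtr q = q).
  { intros q Hq. apply HP in Hq. destruct q; easy. }
  induction k as [| k IH]; [easy |].
  intros G f PG (V & U & T & -> & HV & HU & _ & HT).
  assert (X : forall q D, In q P -> ~ G q -> prime iGL D -> reach G D -> D q ->
    D (boxtr (disj T))).
  { intros q D Hq HGq PD HR HD.
    destruct (HT D PD HR) as [g [Hg Hc]].
    - apply (cnt_lt P G D q); auto.
      intros q' Hq'. apply (reach_parb iGL); auto.
    - rewrite boxtr_disj. apply (prime_disj iGL); auto.
      exists (boxtr g). split; [now apply in_map | now apply IH]. }
  cbn [boxtr]. apply (prime_and iGL G); auto. split; apply (prime_conj iGL); auto.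
  - intros q Hq. apply HV in Hq as [Hq HG]. now rewrite Hb.
  - intros A HA. apply in_map_iff in HA as [q [<- Hq]].
    apply HU in Hq as [Hq HG]. cbn [boxtr]. rewrite (Hb q Hq).
    apply (prime_and iGL G); auto.
    assert (I : forall D, prime iGL D -> reach G D -> D (Imp q (boxtr (disj T)))).
    { intros D PD HR. apply (prime_imp iGL); auto.
      intros E PE HE. apply (X q E); auto.
      intros C HC HBC. apply HE. now apply HR. }
    split.
    + apply I; auto. intros C HC _. exact HC.
    (* Refuting the boxed half gives a theory containing every [C] with [Box C] in [G]; it is
       [reach]-accessible, so [I] applies to it. *)
    + apply NNPP. intros K.
      destruct (prime_box iGL G _ N PG K) as [D [PD [HD HnD]]].
      apply HnD, I; auto. intros C _ HC. now apply HD.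
Qed.

Lemma char_NNIL P k : (forall q, In q P -> parb q) ->
  forall G f, char P k G f -> NNIL f /\ L0 (fun q => In q P) f.
Proof.
  intros HP.
  assert (Hat : forall q, In q P -> atomb q).
  { intros q Hq. apply HP in Hq. destruct q; easy. }
  assert (Hconj : forall l, (forall A, In A l -> NNIL A /\ L0 (fun q => In q P) A) ->
    NNIL (conj l) /\ L0 (fun q => In q P) (conj l)).
  { induction l as [| A l IH]; intros H.
    - split; [apply NNIL_imp; repeat constructor | apply L0_imp; apply L0_bot].
    - destruct (H A) as [H1 H2]; [now left |].
      destruct IH as [H3 H4]; [intros B HB; apply H; now right |].
      split; [now apply NNIL_and | now apply L0_and]. }
  assert (Hdisj : forall l, (forall A, In A l -> NNIL A /\ L0 (fun q => In q P) A) ->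
    NNIL (disj l) /\ L0 (fun q => In q P) (disj l)).
  { induction l as [| A l IH]; intros H.
    - split; [repeat constructor | apply L0_bot].
    - destruct (H A) as [H1 H2]; [now left |].
      destruct IH as [H3 H4]; [intros B HB; apply H; now right |].
      split; [now apply NNIL_or | now apply L0_or]. }
  induction k as [| k IH]; [easy |].
  intros G f (V & U & T & -> & HV & HU & HS & _).
  destruct (Hconj V) as [V1 V2].
  { intros q Hq. apply HV in Hq as [Hq _].
    split; [apply NNIL_at; auto | now apply L0_in]. }
  destruct (Hdisj T) as [T1 T2].
  { intros g Hg. destruct (HS g Hg) as (D & _ & _ & HD). eapply IH; eauto. }
  destruct (Hconj (map (fun q => Imp q (disj T)) U)) as [U1 U2].
  { intros A HA. apply in_map_iff in HA as [q [<- Hq]].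
    apply HU in Hq as [Hq _].
    split; [apply NNIL_imp | apply L0_imp]; auto.
    - apply NI_at; auto.
    - now apply L0_in. }
  split; [now apply NNIL_and | now apply L0_and].
Qed.

(* Nodes of the model that witnesses [char_derives]: variables are read off the
   first theory, parameters and boxed formulas off the second. *)
Record pair_world (P : list form) : Type := {
  pw_var : form -> Prop;
  pw_box : form -> Prop;
  pw_var_prime : prime iGL pw_var;
  pw_box_prime : prime iGL pw_box;
  pw_agree : forall q, In q P -> (pw_var q <-> pw_box q);
  pw_char : exists k f, char P k pw_box f /\ pw_var (boxtr f) }.

Definition pw_le (P : list form) (w v : pair_world P) : Prop :=
  (forall C, pw_var P w C -> pw_var P v C) /\ reach (pw_box P w) (pw_box P v).

Definition pw_val (P : list form) (w : pair_world P) (A : form) : Prop :=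
  match A with
  | Var _ => pw_var P w A
  | Par _ | Box _ => pw_box P w A
  | _ => False
  end.

Lemma pw_kripke P : kripke (pw_le P) (pw_val P).
Proof.
  split.
  - intros w. split; [auto |]. intros C HC _. exact HC.
  - intros u v w [H1 H2] [H3 H4]. split; [auto |].
    eapply (reach_trans iGL); eauto using iGL_normal, pw_box_prime.
  - intros w v [n | n | | | | | A] [H1 H2]; simpl; auto;
      apply (reach_parb iGL); simpl; auto using iGL_normal, pw_box_prime.
Qed.

(** The formula [f] lets [G] be moved along [reach] until it agrees with [H] on [P]; every move
    lowers [k]. *)
Lemma pw_exists P : (forall q, In q P -> parb q) ->
  forall k G f H, prime iGL G -> prime iGL H -> char P k G f -> H (boxtr f) ->
  exists w, pw_var P w = H /\ reach G (pw_box P w).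
Proof.
  intros HP. pose proof iGL_normal as N.
  assert (Hb : forall q, In q P -> boxtr q = q).
  { intros q Hq. apply HP in Hq. destruct q; easy. }
  induction k as [| k IH]; [easy |].
  intros G f H PG PH HC Hf. pose proof HC as (V & U & T & E & HV & HU & HS & _).
  assert (Hf' := Hf). rewrite E in Hf'.
  apply (prime_and iGL H) in Hf' as [F1 F2]; auto.
  rewrite (prime_conj iGL H) in F1, F2 by auto.
  (* Either [H] makes an atom of [U] true and so selects a disjunct of [T], or [H] and [G] already
     agree on [P]. *)
  destruct (classic (exists q, In q U /\ H q)) as [[q [Hq HHq]] | K].
  - specialize (F2 _ (in_map (fun q => Imp q (disj T)) U q Hq)).
    apply HU in Hq as [Hq _].
    cbn [boxtr] in F2. rewrite (Hb q Hq) in F2.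
    apply (prime_and iGL H) in F2 as [F2 _]; auto.
    pose proof (prime_mp iGL H PH _ _ F2 HHq) as F3.
    rewrite boxtr_disj in F3. apply (prime_disj iGL H) in F3 as [A [HA HHA]]; auto.
    apply in_map_iff in HA as [g [<- Hg]].
    destruct (HS g Hg) as (D & PD & HR & HD).
    destruct (IH D g H PD PH HD HHA) as [w [W1 W2]].
    exists w. split; [exact W1 |]. now apply (reach_trans iGL G D).
  - assert (Hag : forall q, In q P -> (H q <-> G q)).
    { intros q Hq. split; intros Hx.
      - apply NNPP. intros Kq. apply K. exists q. split; [now apply HU | exact Hx].
      - rewrite <- (Hb q Hq). apply F1. now apply HV. }
    unshelve eexists.
    { refine {| pw_var := H; pw_box := G |}; auto. now exists (S k), f. }
    split; [reflexivity |]. intros C HC' _. exact HC'.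
Qed.

(** The modal axioms speak about boxes and parameters only, and those are evaluated in the second
    component, itself a prime theory of [iGL]. *)
Lemma pw_sound P A : iGL A -> forall w, force (pw_le P) (pw_val P) w A.
Proof.
  intros D. pose proof iGL_normal as N. pose proof (pw_kripke P) as K.
  induction D as [A HA | A HA | A B _ IH1 _ IH2]; intros w.
  - destruct HA as [A' [B HB | B C | B | n] | B]; cbn [force pw_val].
    + now apply force_ipc.
    + intros v Hv H1 u Hu H2.
      apply (prime_mp iGL _ (pw_box_prime P u) (Box B)); [| exact H2].
      apply (prime_mp iGL _ (pw_box_prime P u) (Box (Imp B C))).
      * apply (prime_iGL iGL); auto using pw_box_prime. apply gl_k4, k4_K.
      * exact (kripke_val _ _ K v u (Box (Imp B C)) Hu H1).
    + intros v _. apply (prime_4 iGL); auto using pw_box_prime.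
    + intros v _. apply (prime_parb iGL); simpl; auto using pw_box_prime.
    + intros v _. apply (prime_lob iGL); auto using pw_box_prime.
  - apply (prime_logic iGL _ (pw_box_prime P w)). now apply d_bax.
  - exact (IH1 w w (kripke_refl _ _ K w) (IH2 w)).
Qed.

Lemma L0_parb_inv A : L0 parb A ->
  match A with
  | Var _ => False
  | And B C | Or B C | Imp B C => L0 parb B /\ L0 parb C
  | _ => True
  end.
Proof. intros H. destruct H as [[] | | | |]; simpl in *; tauto. Qed.

Lemma NI_inv A : NI A ->
  match A with
  | And B C | Or B C => NI B /\ NI C
  | Imp B C => False
  | _ => True
  end.
Proof. intros H. destruct H as [[] | |]; simpl in *; tauto. Qed.

Lemma NNIL_inv A : NNIL A ->
  match A with
  | And B C | Or B C => NNIL B /\ NNIL C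
  | Imp B C => NI B /\ NNIL C
  | _ => True
  end.
Proof. intros H. destruct H as [[] | | |]; simpl in *; tauto. Qed.

Lemma pw_NI P B : NI (boxtr B) -> L0 parb (boxtr B) ->
  forall w, force (pw_le P) (pw_val P) w (boxtr B) <-> pw_box P w (boxtr B).
Proof.
  pose proof iGL_normal as N.
  induction B as [n | n | | B1 IH1 B2 IH2 | B1 IH1 B2 IH2 | B1 IH1 B2 IH2 | B IH];
    cbn [boxtr]; intros HN HL w; try reflexivity.
  - apply L0_parb_inv in HL as [HL _]. now apply L0_parb_inv in HL.
  - split; [easy |]. apply (prime_bot iGL), pw_box_prime.
  - apply NI_inv in HN. apply L0_parb_inv in HL.
    rewrite (prime_and iGL (pw_box P w)) by auto using pw_box_prime.
    cbn [force]. rewrite IH1, IH2; tauto.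
  - apply NI_inv in HN. apply L0_parb_inv in HL.
    rewrite (prime_or_iff iGL (pw_box P w)) by auto using pw_box_prime.
    cbn [force]. rewrite IH1, IH2; tauto.
  - apply NI_inv in HN as [HN _]. now apply NI_inv in HN.
Qed.

(** Only one direction holds for implications: the frame may have too few nodes for the converse.
    The antecedent is in [NI], where [pw_NI] gives both directions, and the translated implication
    persists along [reach]. *)
Lemma pw_NNIL P B : NNIL (boxtr B) -> L0 parb (boxtr B) ->
  forall w, pw_box P w (boxtr B) -> force (pw_le P) (pw_val P) w (boxtr B).
Proof.
  pose proof iGL_normal as N.
  induction B as [n | n | | B1 IH1 B2 IH2 | B1 IH1 B2 IH2 | B1 IH1 B2 IH2 | B IH];
    cbn [boxtr]; intros HN HL w Hw; try exact Hw.
  - apply L0_parb_inv in HL as [HL _]. now apply L0_parb_inv in HL.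
  - destruct (prime_bot iGL _ (pw_box_prime P w) Hw).
  - apply NNIL_inv in HN. apply L0_parb_inv in HL.
    apply (prime_and iGL (pw_box P w)) in Hw; auto using pw_box_prime.
    cbn [force]. split; [apply IH1 | apply IH2]; tauto.
  - apply NNIL_inv in HN. apply L0_parb_inv in HL.
    apply (prime_or_iff iGL (pw_box P w)) in Hw; auto using pw_box_prime.
    cbn [force]. destruct Hw; [left; apply IH1 | right; apply IH2]; tauto.
  - apply NNIL_inv in HN as [HN _]. apply NNIL_inv in HN as [HN1 HN2].
    apply L0_parb_inv in HL as [HL _]. apply L0_parb_inv in HL as [HL1 HL2].
    apply (prime_and iGL (pw_box P w)) in Hw as [H1 H2]; auto using pw_box_prime.
    split; [| exact H2].
    intros v [_ Hv] Hf. apply IH2; auto.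
    apply (pw_NI P B1 HN1 HL1) in Hf.
    apply (prime_mp iGL _ (pw_box_prime P v) (boxtr B1)); [| exact Hf].
    now apply Hv.
Qed.

Fixpoint parbs (A : form) : list form :=
  match A with
  | Var _ | Bot => []
  | Par _ => [A]
  | And B C | Or B C | Imp B C => parbs B ++ parbs C
  | Box B => A :: parbs B
  end.

Lemma pw_truth P A : (forall q, In q P -> parb q) -> incl (parbs A) P ->
  forall w, force (pw_le P) (pw_val P) w A <-> pw_var P w A.
Proof.
  intros HP. pose proof iGL_normal as N.
  induction A as [n | n | | B1 IH1 B2 IH2 | B1 IH1 B2 IH2 | B1 IH1 B2 IH2 | B IH];
    cbn [parbs]; intros HI w; cbn [force pw_val]; try reflexivity;
    try apply incl_app_inv in HI as [HI1 HI2].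
  - symmetry. apply pw_agree, HI. now left.
  - split; [easy |]. apply (prime_bot iGL), pw_var_prime.
  - rewrite (prime_and iGL (pw_var P w)) by auto using pw_var_prime.
    rewrite IH1, IH2; tauto.
  - rewrite (prime_or_iff iGL (pw_var P w)) by auto using pw_var_prime.
    rewrite IH1, IH2; tauto.
  - split; intros H.
    + apply (prime_imp iGL); auto using pw_var_prime.
      (* An extension [D] of the first component still contains the characteristic formula of the
         second, so [pw_exists] supplies a node above [w] with first component [D]. *)
      intros D PD HD HB. destruct (pw_char P w) as (k & f & Hc & Hf).
      destruct (pw_exists P HP k _ f D (pw_box_prime P w) PD Hc) as [v [<- Hv]]; auto.
      apply IH2; auto. apply H; [split; auto |]. now apply IH1.
    + intros v [Hv _] HB. apply IH2; auto. apply IH1 in HB; auto.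
      apply (prime_mp iGL _ (pw_var_prime P v) B1); auto.
  - symmetry. apply pw_agree, HI. now left.
Qed.

(** Given a theory [H] containing the translation of [f], take a node over [H] whose second
    component is reachable from [G]. There [E] persists, hence is forced, hence [A] is forced and
    lies in [H]. *)
Lemma char_derives P k G f E A :
  (forall q, In q P -> parb q) -> incl (parbs A) P ->
  prime iGL G -> char P k G f ->
  inS E -> NNILbox E -> G E -> iGL (Imp E A) -> iGL (Imp (boxtr f) A).
Proof.
  intros HP HI PG Hc [B ->] [HN HL] HG HE. pose proof iGL_normal as N.
  apply prime_implies; [exact N |]. intros H PH HH.
  destruct (pw_exists P HP k G f H PG PH Hc HH) as [w [<- Hw]].
  apply (pw_truth P A HP HI w).
  apply (pw_sound P _ HE w w (kripke_refl _ _ (pw_kripke P) w)).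
  apply pw_NNIL; auto. apply Hw; [exact HG |]. now apply (prime_boxtr iGL).
Qed.

Lemma NNIL_approximation P A :
  (forall q, In q P -> parb q) -> incl (parbs A) P ->
  exists l, (forall f, In f l ->
      NNIL f /\ L0 (fun q => In q P) f /\ iGL (Imp (boxtr f) A)) /\
    pres iGL (fun E => inS E /\ NNILbox E) A (disj (map boxtr l)).
Proof.
  intros HP HI. pose proof iGL_normal as N.
  destruct (char_exists P (S (length P))) as [l Hl].
  destruct (sublists_spec (fun f =>
    NNIL f /\ L0 (fun q => In q P) f /\ iGL (Imp (boxtr f) A)) l) as [l' [_ Hl']].
  exists l'. split; [intros f Hf; now apply Hl' |].
  intros E [HS HNb] HE. apply prime_implies; [exact N |]. intros G PG HG.
  destruct (Hl G PG) as [f [Hf Hc]]; [lia |].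
  apply (prime_disj iGL G); auto. exists (boxtr f). split.
  - apply in_map, Hl'. split; [exact Hf |].
    destruct (char_NNIL P _ HP G f Hc) as [H1 H2]. repeat split; auto.
    now apply (char_derives P (S (length P)) G f E A).
  - now apply (char_mem P (S (length P))).
Qed.

(** * The target model *)

Definition hworld : Type := { G : form -> Prop | prime iGLHbox G }.
Definition thy (w : hworld) : form -> Prop := proj1_sig w.

Lemma thy_prime w : prime iGLHbox (thy w).
Proof. exact (proj2_sig w). Qed.

Definition hle (w v : hworld) : Prop := forall C, thy w C -> thy v C.

Definition hR (P : list form) (w v : hworld) : Prop :=
  (forall C, thy w (Box C) -> thy v C) /\ cnt P (thy w) < cnt P (thy v).

Lemma hle_hR P w v u : hle w v -> hR P v u -> hR P w u.
Proof.
  intros H [H1 H2]. split; [auto |].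
  eapply Nat.le_lt_trans; [apply cnt_le | exact H2]. auto.
Qed.

Lemma hR_hle P w v u : hR P w v -> hle v u -> hR P w u.
Proof.
  intros [H1 H2] H. split; [auto |].
  eapply Nat.lt_le_trans; [exact H2 | apply cnt_le]. auto.
Qed.

Lemma hR_trans P w v u : hR P w v -> hR P v u -> hR P w u.
Proof.
  intros [H1 H2] [H3 H4]. split; [| lia]. intros C HC. apply H3, H1.
  apply (prime_4 iGLHbox); auto using iGLHbox_normal, thy_prime.
Qed.

(** Converse well-foundedness: the count grows along [hR] and is bounded by [length P]. *)
Lemma hR_ind P (Q : hworld -> Prop) :
  (forall w, (forall v, hR P w v -> Q v) -> Q w) -> forall w, Q w.
Proof.
  intros H. assert (K : forall k w, length P - cnt P (thy w) < k -> Q w).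
  { induction k as [| k IH]; intros w Hk; [lia |].
    apply H. intros v [_ Hv]. apply IH. pose proof (cnt_length P (thy v)). lia. }
  intros w. apply (K (S (length P - cnt P (thy w)))). lia.
Qed.

(* [Var (to_nat (k, 0))] says that at least [k] members of [P] hold;
   [Var (to_nat (k, S n))] says that more than [k] hold, or exactly [k] and
   [Var n] too. Both persist along [hR], even though [Var n] need not. *)
Definition hvar (P : list form) (w : hworld) (m : nat) : Prop :=
  let (k, i) := of_nat m in
  match i with
  | 0 => k <= cnt P (thy w)
  | S n => k < cnt P (thy w) \/ (k = cnt P (thy w) /\ thy w (Var n))
  end.

Definition hatom (P : list form) (box : hworld -> form -> Prop)
  (w : hworld) (A : form) : Prop :=
  match A with
  | Var m => hvar P w m
  | Par _ => thy w A
  | Box B => box w B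
  | _ => False
  end.

(* Truth of a box refers to boxes at successors only; [k] is fuel, and any fuel
   above [length P - cnt P (thy w)] gives the same value. *)
Fixpoint hboxk (P : list form) (k : nat) (w : hworld) (A : form) : Prop :=
  match k with
  | 0 => True
  | S k => forall v, hR P w v -> exists E, inS E /\ NNIL E /\
      iGLCa (Imp E A) /\ force hle (hatom P (hboxk P k)) v E
  end.

Definition hbox (P : list form) : hworld -> form -> Prop := hboxk P (S (length P)).

Definition sat (P : list form) : hworld -> form -> Prop :=
  force hle (hatom P (hbox P)).

Lemma hboxk_stable P k1 : forall k2 w A,
  length P < k1 + cnt P (thy w) -> length P < k2 + cnt P (thy w) ->
  (hboxk P k1 w A <-> hboxk P k2 w A).
Proof.
  induction k1 as [| k1 IH]; intros k2 w A H1 H2.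
  { pose proof (cnt_length P (thy w)). lia. }
  destruct k2 as [| k2].
  { pose proof (cnt_length P (thy w)). lia. }
  (* Successors have larger count, so one unit less of fuel suffices for the boxes inside [E]. *)
  assert (X : forall v E, hR P w v ->
    (force hle (hatom P (hboxk P k1)) v E <-> force hle (hatom P (hboxk P k2)) v E)).
  { intros v E [_ Hv]. apply force_ext.
    - intros x y z Hx Hy C HC. auto.
    - intros C HC. exact HC.
    - intros u [m | n | | | | | B] Hu; cbn [hatom]; try tauto.
      assert (cnt P (thy v) <= cnt P (thy u)) by (apply cnt_le; intros; now apply Hu).
      apply IH; lia.
    - intros u _ C HC. exact HC. }
  cbn [hboxk]. split; intros H v Hv; destruct (H v Hv) as (E & E1 & E2 & E3 & E4);
    exists E; repeat split; auto; now apply X.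
Qed.

Lemma hbox_iff P w A : hbox P w A <->
  forall v, hR P w v -> exists E, inS E /\ NNIL E /\ iGLCa (Imp E A) /\ sat P v E.
Proof.
  unfold hbox at 1.
  (* With one extra unit of fuel, unfolding leaves exactly [hbox] for the inner boxes. *)
  rewrite (hboxk_stable P _ (S (S (length P)))) by lia. reflexivity.
Qed.

Lemma hbox_le P w v A : hle w v -> hbox P w A -> hbox P v A.
Proof.
  rewrite !hbox_iff. intros H HB u Hu. apply HB. now apply (hle_hR P w v).
Qed.

Lemma hvar_le P w v m : hle w v -> hvar P w m -> hvar P v m.
Proof.
  unfold hvar. destruct (of_nat m) as [k [| n]]; intros H;
    assert (cnt P (thy w) <= cnt P (thy v)) by (apply cnt_le; auto); [lia |].
  intros [Hk | [Hk Hn]]; [lia |].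
  destruct (Nat.eq_dec k (cnt P (thy v))); [right; auto | lia].
Qed.

Lemma hvar_R P w v m : hR P w v -> hvar P w m -> hvar P v m.
Proof.
  unfold hvar. intros [_ H]. destruct (of_nat m) as [k [| n]]; lia.
Qed.

Lemma sat_kripke P : kripke hle (hatom P (hbox P)).
Proof.
  split.
  - intros w C HC. exact HC.
  - intros u v w H1 H2 C HC. auto.
  - intros w v [m | n | | | | | B] H; cbn [hatom]; auto.
    + now apply hvar_le.
    + now apply hbox_le.
Qed.

Lemma iGLCa_boxtr E : inS E -> iGLCa (Imp E (Box E)).
Proof.
  intros [B ->]. apply prime_implies; [apply iGLCa_normal |].
  intros G PG. apply (prime_boxtr iGLCa); auto using iGLCa_normal.
Qed.

Lemma inS_top : inS (boxtr Top) /\ NNIL (boxtr Top).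
Proof.
  split; [now exists Top |]. apply NNIL_and; [apply NNIL_imp |];
    constructor; exact I.
Qed.

Lemma hbox_theorem P A : iGLCa A -> forall w, hbox P w A.
Proof.
  intros HA w. revert A HA. induction w as [w IH] using (hR_ind P). intros A HA.
  apply hbox_iff. intros v Hv. destruct inS_top as [T1 T2].
  exists (boxtr Top). repeat split; auto.
  - apply prime_implies; [apply iGLCa_normal |]. intros G PG _.
    now apply (prime_logic iGLCa).
  - intros u _ HB. exact HB.
  (* The witness contains the box of [Imp Bot Bot], a theorem, to which the induction hypothesis at
     [v] applies. *)
  - apply IH; [exact Hv |]. apply normal_ipc; [apply iGLCa_normal | apply ax_efq].
Qed.

Lemma hbox_K P w A B : hbox P w (Imp A B) -> hbox P w A -> hbox P w B.
Proof.
  rewrite !hbox_iff. intros H1 H2 v Hv.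
  destruct (H1 v Hv) as (E & [E0 ->] & E2 & E3 & E4).
  destruct (H2 v Hv) as (F & [F0 ->] & F2 & F3 & F4).
  exists (And (boxtr E0) (boxtr F0)). repeat split; auto.
  - now exists (And E0 F0).
  - now apply NNIL_and.
  - apply prime_implies; [apply iGLCa_normal |]. intros G PG HG.
    apply (prime_and iGLCa G) in HG as [HE HF]; auto using iGLCa_normal.
    apply (prime_mp iGLCa G PG A).
    + apply (prime_mp iGLCa G PG (boxtr E0)); [| exact HE].
      now apply (prime_logic iGLCa).
    + apply (prime_mp iGLCa G PG (boxtr F0)); [| exact HF].
      now apply (prime_logic iGLCa).
Qed.

Lemma iGLCa_box_mono E A : inS E -> iGLCa (Imp E A) -> iGLCa (Imp E (Box A)).
Proof.
  intros HS HE. apply prime_implies; [apply iGLCa_normal |]. intros G PG HG.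
  apply (prime_box1 iGLCa G E A iGLCa_normal PG HE).
  apply (prime_mp iGLCa G PG E); [| exact HG].
  now apply (prime_logic iGLCa), iGLCa_boxtr.
Qed.

Lemma hbox_4 P w A : hbox P w A -> hbox P w (Box A).
Proof.
  rewrite !hbox_iff. intros H v Hv. destruct (H v Hv) as (E & E1 & E2 & E3 & E4).
  exists E. repeat split; auto. now apply iGLCa_box_mono.
Qed.

(** The witness stays the same. Since [E] implies its own box, it yields the boxed premise, then
    [Box A] by the schema inside [iGLCa], and finally [A]. *)
Lemma hbox_lob P w A : hbox P w (Imp (Box A) A) -> hbox P w A.
Proof.
  rewrite !hbox_iff. intros H v Hv. destruct (H v Hv) as (E & E1 & E2 & E3 & E4).
  exists E. repeat split; auto.
  pose proof (iGLCa_box_mono E _ E1 E3) as E5.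
  apply prime_implies; [apply iGLCa_normal |]. intros G PG HG.
  apply (prime_mp iGLCa G PG (Box A)).
  - apply (prime_mp iGLCa G PG E); [| exact HG]. now apply (prime_logic iGLCa).
  - apply (prime_lob iGLCa); auto using iGLCa_normal.
    apply (prime_mp iGLCa G PG E); [| exact HG]. now apply (prime_logic iGLCa).
Qed.

(* A boxed formula of the shape [Boxdot A] can serve as its own witness. *)
Lemma hbox_boxdot P A : inS (Boxdot A) -> NNIL (Boxdot A) ->
  forall w, (forall v, hR P w v -> sat P v A) -> hbox P w A.
Proof.
  intros HS HN w. induction w as [w IH] using (hR_ind P). intros H.
  apply hbox_iff. intros v Hv. exists (Boxdot A). repeat split; auto.
  - apply normal_ipc; [apply iGLCa_normal | constructor].
  - apply H, Hv.
  - apply IH; [exact Hv |]. intros u Hu. apply H. now apply (hR_trans P w v).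
Qed.

Lemma hbox_var P w m : hvar P w m -> hbox P w (Var m).
Proof.
  intros H. apply hbox_boxdot.
  - now exists (Var m).
  - apply NNIL_and; now constructor.
  - intros v Hv. now apply (hvar_R P w).
Qed.

Lemma hbox_par P w n : thy w (Par n) -> hbox P w (Par n).
Proof.
  intros H. apply hbox_iff. intros v Hv. exists (Par n). repeat split.
  - now exists (Par n).
  - now constructor.
  - apply prime_implies; auto using iGLCa_normal.
  - apply Hv. apply (prime_parb iGLHbox); simpl; auto using iGLHbox_normal, thy_prime.
Qed.

Lemma sat_iGLCa P A : iGLCa A -> forall w, sat P w A.
Proof.
  intros D. pose proof (sat_kripke P) as K.
  induction D as [A HA | A HA | A B _ IH1 _ IH2]; intros w.
  - destruct HA as [[A' [B HB | B C | B | n] | B] | [m | n]]; cbn [sat force hatom].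
    + now apply force_ipc.
    + intros v _ H1 u Hu H2. apply (hbox_K P u B); [| exact H2].
      now apply (hbox_le P v).
    + intros v _. apply hbox_4.
    + intros v _. apply hbox_par.
    + intros v _. apply hbox_lob.
    + intros v _. apply hbox_var.
    + intros v _. apply hbox_par.
  - apply hbox_theorem. now apply d_ax.
  - exact (IH1 w w (kripke_refl _ _ K w) (IH2 w)).
Qed.

Lemma sat_pres P A B :
  pres iGLCa (fun E => inS E /\ NNIL E) A B -> forall w, sat P w (Imp (Box A) (Box B)).
Proof.
  intros H w v _. cbn [force hatom]. rewrite !hbox_iff.
  intros HA u Hu. destruct (HA u Hu) as (E & E1 & E2 & E3 & E4).
  exists E. repeat split; auto.
Qed.

Lemma sat_iGLCaHsigma P A : iGLCaHsigma A -> forall w, sat P w A.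
Proof.
  intros D. pose proof (sat_kripke P) as K.
  induction D as [A HA | A B HP | A B HP | A B _ IH1 _ IH2]; intros w.
  - now apply sat_iGLCa.
  - now apply sat_pres.
  (* An implication between boxes is NNIL and its translation is its own [Boxdot], so it is its own
     witness. *)
  - apply hbox_boxdot.
    + now exists (Imp (Box A) (Box B)).
    + apply NNIL_and; [apply NNIL_imp |]; now constructor.
    + intros v _. now apply sat_pres.
  - exact (IH1 w w (kripke_refl _ _ K w) (IH2 w)).
Qed.

(** * The substitution *)

(** The range of [k] covers all possible counts, from 0 to [length P]. *)
Definition hsubst (P : list form) (n : nat) : form :=
  conj (map (fun k => Imp (Var (to_nat (k, 0))) (Var (to_nat (k, S n))))
            (seq 0 (S (length P)))).

Lemma sat_conj P w l : sat P w (conj l) <-> forall A, In A l -> sat P w A.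
Proof.
  induction l as [| B l IH].
  - split; [intros _ A [] | intros _ v _ H; exact H].
  - change (sat P w (conj (B :: l))) with (sat P w B /\ sat P w (conj l)).
    rewrite IH. split.
    + intros [H1 H2] A [<- | H]; auto.
    + intros H. split; [| intros A HA]; apply H; simpl; auto.
Qed.

Lemma sat_hsubst P w n : sat P w (hsubst P n) <-> thy w (Var n).
Proof.
  unfold hsubst. rewrite sat_conj. split.
  (* The conjunct indexed by the actual count of [w], tested at [w] itself, leaves only the case
     that [Var n] holds. *)
  - intros H. set (k := cnt P (thy w)).
    assert (Hk : In k (seq 0 (S (length P)))).
    { apply in_seq. pose proof (cnt_length P (thy w)). unfold k. lia. }
    specialize (H _ (in_map (fun k => Imp (Var (to_nat (k, 0)))
                                 (Var (to_nat (k, S n)))) _ _ Hk)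
                  w (kripke_refl _ _ (sat_kripke P) w)).
    cbn [force hatom] in H. unfold hvar in H. rewrite !cancel_of_to in H.
    destruct H as [H | [_ H]]; [unfold k; lia | unfold k in H; lia | exact H].
  - intros H A HA. apply in_map_iff in HA as [k [<- _]].
    intros v Hv. cbn [force hatom]. unfold hvar. rewrite !cancel_of_to.
    intros Hk. destruct (Nat.eq_dec k (cnt P (thy v))); [right; auto | left; lia].
Qed.

(** A variable would break this, since [boxtr] would then act inside [theta n]; parameters and boxes
    are fixed by [boxtr] before and after substituting. *)
Lemma subst_boxtr theta B : L0 parb B ->
  subst theta (boxtr B) = boxtr (subst theta B).
Proof.
  intros H. induction B; apply L0_parb_inv in H; simpl in *; try tauto;
    unfold Boxdot; try (f_equal; tauto).
  simpl. destruct H as [H1 H2]. now rewrite IHB1, IHB2 by assumption.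
Qed.

Lemma NI_subst_boxtr theta B : L0 parb B -> NI B -> NI (subst theta (boxtr B)).
Proof.
  intros H N. induction B; apply L0_parb_inv in H; apply NI_inv in N; simpl in *;
    try tauto; try (now constructor); [apply NI_and | apply NI_or]; tauto.
Qed.

Lemma NNIL_subst_boxtr theta B :
  L0 parb B -> NNIL B -> NNIL (subst theta (boxtr B)).
Proof.
  intros H N. induction B; apply L0_parb_inv in H; apply NNIL_inv in N; simpl in *;
    try tauto; try (now constructor); [apply NNIL_and; tauto | apply NNIL_or; tauto |].
  apply NNIL_and; [apply NNIL_imp |].
  - apply NI_subst_boxtr; tauto.
  - tauto.
  - now constructor.
Qed.

(** The axioms of [iGL] are schematic except for those on parameters, which substitutions fix. The
    completeness axioms of [iGLCa] for variables are not schematic, hence the premise in [iGL]. *)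
Lemma iGLCa_subst theta A : iGL A -> iGLCa (subst theta A).
Proof.
  assert (X : forall A, iGL_ax A -> iGL_ax (subst theta A)).
  { intros B [C [D HD | D1 D2 | D | n] | C]; simpl.
    - apply gl_k4, k4_ipc. destruct HD; constructor.
    - apply gl_k4, k4_K.
    - apply gl_k4, k4_4.
    - apply gl_k4, k4_par.
    - apply gl_lob. }
  intros D. induction D as [A HA | A HA | A B _ IH1 _ IH2].
  - apply d_ax. left. auto.
  - simpl. apply d_bax. left. auto.
  - exact (d_mp _ _ _ IH1 IH2).
Qed.

Lemma sat_NI P theta (Q : form -> Prop) B :
  L0 Q B -> (forall q, Q q -> parb q) -> NI B ->
  forall w, (forall q, Q q -> (thy w q <-> sat P w (subst theta q))) ->
  (thy w (boxtr B) <-> sat P w (subst theta (boxtr B))).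
Proof.
  intros HL HQ HN w H. pose proof iGLHbox_normal as N. pose proof (thy_prime w) as PW.
  induction HL as [A HA | | A B _ IH1 _ IH2 | A B _ IH1 _ IH2 | A B _ IH1 _ IH2];
    try (apply NI_inv in HN; cbn [boxtr subst]; unfold sat; cbn [force]).
  - specialize (HQ A HA). specialize (H A HA). destruct A; easy.
  - split; [| easy]. apply (prime_bot iGLHbox _ PW).
  - rewrite (prime_and iGLHbox (thy w)) by assumption. unfold sat in *. tauto.
  - rewrite (prime_or_iff iGLHbox (thy w)) by assumption. unfold sat in *. tauto.
  - contradiction.
Qed.

Lemma L0_mono (Q Q' : form -> Prop) A :
  (forall q, Q q -> Q' q) -> L0 Q A -> L0 Q' A.
Proof.
  intros H D. induction D;
    [now apply L0_in, H | apply L0_bot | now apply L0_and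
    | now apply L0_or | now apply L0_imp].
Qed.

(** Truth values of the atoms are compared at [hR]-successors as well, because a translated
    implication carries a box. *)
Lemma sat_NNIL P theta (Q : form -> Prop) B :
  L0 Q B -> (forall q, Q q -> parb q) -> NNIL B ->
  forall w,
  (forall v, hle w v \/ hR P w v ->
     forall q, Q q -> (thy v q <-> sat P v (subst theta q))) ->
  thy w (boxtr B) -> sat P w (subst theta (boxtr B)).
Proof.
  intros HL HQ. pose proof iGLHbox_normal as N.
  pose proof (kripke_refl _ _ (sat_kripke P)) as R.
  induction HL as [A HA | | A B HA IH1 HB IH2 | A B HA IH1 HB IH2 | A B HA IH1 HB IH2];
    intros HN w H Hw; pose proof (thy_prime w) as PW.
  - pose proof (HQ A HA) as HqA.
    destruct A; try contradiction; now apply (H w (or_introl (R w)) _ HA).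
  - destruct (prime_bot iGLHbox _ PW Hw).
  - apply NNIL_inv in HN as [N1 N2]. cbn [boxtr] in Hw.
    apply (prime_and iGLHbox (thy w)) in Hw as [H1 H2]; auto.
    split; [apply IH1 | apply IH2]; auto.
  - apply NNIL_inv in HN as [N1 N2]. cbn [boxtr] in Hw.
    apply (prime_or_iff iGLHbox (thy w)) in Hw as [H1 | H1]; auto;
      [left; apply IH1 | right; apply IH2]; auto.
  - pose proof HN as HN'. apply NNIL_inv in HN as [N1 N2]. cbn [boxtr] in Hw.
    apply (prime_and iGLHbox (thy w)) in Hw as [H1 H2]; auto.
    set (C := Imp (boxtr A) (boxtr B)) in *.
    (* The unboxed implication is treated at [w] and at its [hR]-successors together: the latter
       give the boxed conjunct. *)
    assert (X : forall v, (v = w \/ hR P w v) -> thy v C -> sat P v (subst theta C)).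
    { intros v Hv HC u Hu HA'.
      assert (Hu' : forall x, hle u x \/ hR P u x -> hle w x \/ hR P w x).
      { intros x [Hx | Hx]; destruct Hv as [-> | Hv].
        - left. intros D HD. auto.
        - right. apply (hR_hle P w u x); [now apply (hR_hle P w v u) | exact Hx].
        - right. now apply (hle_hR P w u).
        - right. apply (hR_trans P w u x); [now apply (hR_hle P w v u) | exact Hx]. }
      apply IH2; auto.
      apply (prime_mp iGLHbox _ (thy_prime u) (boxtr A)); [now apply Hu |].
      apply (sat_NI P theta Q A HA HQ N1 u); [| exact HA'].
      apply H, Hu'. left. exact (R u). }
    assert (LQ : L0 parb (Imp A B)).
    { apply (L0_mono Q parb); auto. now apply L0_imp. }
    split; [apply X; auto |].
    (* The substituted translation is again a translation and NNIL, so it witnesses its own box. *)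
    apply hbox_boxdot.
    + exists (subst theta (Imp A B)). now rewrite <- subst_boxtr.
    + exact (NNIL_subst_boxtr theta (Imp A B) LQ HN').
    + intros v Hv. apply X; [now right |]. now apply Hv.
Qed.

(** * Truth lemma and conclusion *)

Lemma incl_parbs_box A B : In (Box B) (parbs A) -> incl (parbs B) (parbs A).
Proof.
  induction A; simpl; intros H; try tauto.
  - destruct H as [H | []]. discriminate.
  - apply in_app_or in H as [H | H]; [apply incl_appl | apply incl_appr]; auto.
  - apply in_app_or in H as [H | H]; [apply incl_appl | apply incl_appr]; auto.
  - apply in_app_or in H as [H | H]; [apply incl_appl | apply incl_appr]; auto.
  - destruct H as [H | H]; apply incl_tl; [| auto].
    injection H as ->. apply incl_refl.
Qed.

Lemma parbs_parb A q : In q (parbs A) -> parb q.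
Proof.
  induction A; simpl; rewrite ?in_app_iff; try tauto.
  - intros [<- | []]. exact I.
  - intros [<- | H]; [exact I | auto].
Qed.

(** By Löb, the box of [Imp (Box B) B] fails too, which gives a theory with [Box B] but not [B]. The
    new truth of [Box B], a member of [P], makes the count grow as [hR] demands. *)
Lemma hR_exists P w B : (forall q, In q P -> parb q) -> In (Box B) P ->
  ~ thy w (Box B) -> exists v, hR P w v /\ ~ thy v B.
Proof.
  intros HP HB H. pose proof iGLHbox_normal as N. pose proof (thy_prime w) as PW.
  destruct (prime_box iGLHbox (thy w) (Imp (Box B) B) N PW) as [D [PD [HD HnD]]].
  { intros K. apply H. now apply (prime_lob iGLHbox). }
  assert (HE : exists E, prime iGLHbox E /\ (forall C, D C -> E C) /\
                         E (Box B) /\ ~ E B).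
  { apply NNPP. intros K. apply HnD. apply (prime_imp iGLHbox); auto.
    intros E PE HDE HEB. apply NNPP. intros KE. apply K. now exists E. }
  destruct HE as (E & PE & HDE & HEB & HnE).
  exists (exist _ E PE). split; [split |]; simpl; auto.
  apply (cnt_lt P (thy w) E (Box B)); auto.
  intros q Hq Hw. apply HDE, HD. apply (prime_parb iGLHbox); auto.
Qed.

Lemma truth A w B : incl (parbs B) (parbs A) ->
  (thy w B <-> sat (parbs A) w (subst (hsubst (parbs A)) B)).
Proof.
  set (P := parbs A).
  assert (HP : forall q, In q P -> parb q) by exact (parbs_parb A).
  pose proof iGLHbox_normal as N. pose proof (kripke_refl _ _ (sat_kripke P)) as R.
  revert B. induction w as [w IHw] using (hR_ind P).
  (* Inside the induction along [hR], a second one on formulas runs over all extensions of [w], as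
     implications require. *)
  assert (G : forall B, incl (parbs B) P -> forall v, hle w v ->
    (thy v B <-> sat P v (subst (hsubst P) B)));
    [| intros B HB; apply G; [exact HB | apply R]].
  induction B as [n | n | | B IHB C IHC | B IHB C IHC | B IHB C IHC | B IHB];
    cbn [parbs]; intros HI v Hv; pose proof (thy_prime v) as PV;
    try apply incl_app_inv in HI as [HI1 HI2]; cbn [subst].
  - symmetry. apply sat_hsubst.
  - reflexivity.
  - split; [| easy]. apply (prime_bot iGLHbox _ PV).
  - rewrite (prime_and iGLHbox (thy v)), IHB, IHC by auto. reflexivity.
  - rewrite (prime_or_iff iGLHbox (thy v)), IHB, IHC by auto. reflexivity.
  - split.
    + intros H u Hu HB. apply IHC; auto; [intros D HD; auto |].
      apply (prime_mp iGLHbox _ (thy_prime u) B); [now apply Hu |].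
      apply IHB; auto. intros D HD; auto.
    + intros H. apply (prime_imp iGLHbox); auto.
      intros D PD HD HB. pose (u := exist _ D PD : hworld).
      apply (IHC HI2 u); [intros E HE; apply HD; auto |].
      apply H; [exact HD |].
      apply (IHB HI1 u); [intros E HE; apply HD; auto | exact HB].
  - assert (HB : In (Box B) P) by (apply HI; now left).
    assert (HIB : incl (parbs B) P) by (intros q Hq; apply HI; now right).
    split.
    (* The preservativity axiom turns [Box B] into the box of the disjunction of approximations. The
       successor [u] picks a disjunct, whose substitution instance is the required witness. *)
    + intros H. destruct (NNIL_approximation P B HP HIB) as [l [Hl Hpres]].
      apply hbox_iff. intros u Hu.
      assert (HD : thy u (disj (map boxtr l))).
      { apply Hu. apply (prime_mp iGLHbox _ PV (Box B)); [| exact H].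
        apply (prime_logic iGLHbox _ PV). now apply hb_pres. }
      apply (prime_disj iGLHbox) in HD as [f' [Hf' Hu']]; auto using thy_prime.
      apply in_map_iff in Hf' as [f [<- Hf]]. destruct (Hl f Hf) as (F1 & F2 & F3).
      assert (F4 : L0 parb f) by (apply (L0_mono (fun q => In q P)); auto).
      exists (subst (hsubst P) (boxtr f)). repeat split.
      * exists (subst (hsubst P) f). now apply subst_boxtr.
      * now apply NNIL_subst_boxtr.
      * exact (iGLCa_subst (hsubst P) _ F3).
      * apply (sat_NNIL P (hsubst P) (fun q => In q P)); auto.
        intros x Hx q Hq. apply IHw.
        -- destruct Hx as [Hx | Hx].
           ++ apply (hR_hle P w u); [now apply (hle_hR P w v) | exact Hx].
           ++ apply (hR_trans P w u); [now apply (hle_hR P w v) | exact Hx].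
        (* The outer hypothesis applies to [q] because [parbs A] contains the parameters and boxes
           occurring in its own members. *)
        -- pose proof (HP q Hq) as Hpq.
           destruct q as [n | n | | | | | C]; try contradiction; simpl.
           ++ intros q [<- | []]. exact Hq.
           ++ intros q [].
           ++ intros q [<- | Hq']; [exact Hq |]. revert q Hq'.
              now apply incl_parbs_box.
    + intros H. apply NNPP. intros K.
      destruct (hR_exists P v B HP HB K) as [u [Hu Hn]].
      apply Hn. apply (IHw u); [now apply (hle_hR P w v) | exact HIB |].
      apply hbox_iff with (1 := H) in Hu as (E & _ & _ & E3 & E4).
      exact (sat_iGLCa P _ E3 u u (R u) E4).
Qed.

Theorem mainTheorem5 (A : form) :
  ~ iGLHbox A -> exists beta : nat -> form, ~ iGLCaHsigma (subst beta A).
Proof.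
  intros H. exists (hsubst (parbs A)). intros D.
  apply H. apply prime_complete; [apply iGLHbox_normal |]. intros G PG.
  pose (w := exist _ G PG : hworld).
  apply (truth A w A (incl_refl _)). now apply sat_iGLCaHsigma.
Qed.
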